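(* Let $\Gamma$ be a countable amenable group, let $\pi\colon X\to Y$ be a factor map between dynamical systems of $\Gamma$, let $\Gamma\curvearrowright G$ be a dynamical system on a compact metrizable space $G$, and suppose that $X$ is a $G$-extension of $Y$ (via $\pi$). Then $\operatorname{mdim}(X|Y)\ge\operatorname{mdim}(G)$. If moreover $\pi$ admits a continuous section, i.e. a continuous map $\tau\colon Y\to X$ with $\pi\circ\tau=\operatorname{id}_Y$, then $\operatorname{mdim}(X|Y)=\operatorname{mdim}(G)$.
   Context: $\Gamma$ is a countable amenable group and $\mathcal F(\Gamma)$ is the set of nonempty finite subsets of $\Gamma$. For $K\in\mathcal F(\Gamma)$ and $\delta>0$, $\mathcal B(K,\delta)$ is the set of $F\in\mathcal F(\Gamma)$ with $|\{t\in F: Kt\subseteq F\}|\ge(1-\delta)|F|$. For a real-valued $\varphi$ on $\mathcal F(\Gamma)$, $\lim_F\varphi(F)=c$ means: for every $\varepsilon>0$ there are $K\in\mathcal F(\Gamma)$, $\delta>0$ with $|\varphi(F)-c|<\varepsilon$ for all $F\in\mathcal B(K,\delta)$. A dynamical system $\Gamma\curvearrowright X$ is a (nonempty) compact metrizable space $X$ with a continuous action of $\Gamma$. A factor map $\pi\colon X\to Y$ is a continuous $\Gamma$-equivariant surjection. $G$-extension: given a factor map $\pi\colon X\to Y$ and a dynamical system $\Gamma\curvearrowright G$ ($G$ is not required to be a group), $X$ is a $G$-extension of $Y$ if there is a continuous map $X\times G\to X$, $(x,g)\mapsto xg$, such that for all $x\in X$, $g,g'\in G$, $t\in\Gamma$: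 (1) $\pi^{-1}(\pi(x))=xG$; (2) $xg=xg'$ exactly when $g=g'$; (3) $t(xg)=(tx)(tg)$. For a finite open cover $\mathcal U$ of $X$, $\operatorname{ord}(\mathcal U)=\max_{x\in X}\sum_{U\in\mathcal U}1_U(x)-1$. For families of sets, $\mathcal U\vee\mathcal V=\{U\cap V:U\in\mathcal U,V\in\mathcal V\}$, and $\mathcal U$ refines $\mathcal V$ if every element of $\mathcal U$ is contained in some element of $\mathcal V$. For $F\in\mathcal F(\Gamma)$, $\mathcal U^F=\bigvee_{s\in F}s^{-1}\mathcal U$. $\mathcal D(\mathcal U|Y)$ is the minimum of $\operatorname{ord}(\mathcal W)$ over all finite open covers $\mathcal W$ of $X$ such that $\{\pi^{-1}(y)\}_{y\in Y}\vee\mathcal W$ refines $\mathcal U$. The limit $\lim_F\mathcal D(\mathcal U^F|Y)/|F|$ exists, and $$\operatorname{mdim}(X|Y)=\sup_{\mathcal U}\lim_F\frac{\mathcal D(\mathcal U^F|Y)}{|F|}\in[0,\infty],$$ with $\mathcal U$ ranging over all finite open covers of $X$. The mean dimension of a single system is the case when $Y$ is a singleton; thus $\operatorname{mdim}(G)=\sup_{\mathcal U}\lim_F\mathcal D(\mathcal U^F)/|F|$ over finite open covers $\mathcal U$ of $G$, where $\mathcal D(\mathcal U)$ is the minimum of $\operatorname{ord}(\mathcal W)$ over finite open covers $\mathcal W$ of $G$ refining $\mathcal U$. *)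

(* Defs.v *)
From HB Require Import structures.
From mathcomp Require Import all_boot all_order all_algebra.
From mathcomp Require Import finmap.
From mathcomp Require Import all_classical all_reals all_analysis.

Set Implicit Arguments.
Unset Strict Implicit.
Unset Printing Implicit Defensive.

Import Order.TTheory GRing.Theory Num.Theory.
Import numFieldNormedType.Exports.

Local Open Scope classical_set_scope.
Local Open Scope ring_scope.

Section Folner.
Variables (R : realType) (Gamma : groupType).

(* the set B(K, delta) of (K, delta)-invariant nonempty finite sets *)
Definition folner_sets (K : {fset Gamma}) (delta : R) : set {fset Gamma} :=
  [set F | F != fset0 /\
    (1 - delta) * #|` F|%:R <=
      #|` [fset t in F | [fset (k * t)%g | k in K] `<=` F]%fset|%:R].

Definition amenable : Prop :=
  forall (K : {fset Gamma}) (delta : R), K != fset0 -> 0 < delta ->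
    folner_sets K delta !=set0.

(* lim_F is convergence along the filter generated by the sets B(K, delta) *)
Definition folner : set_system {fset Gamma} :=
  filter_from [set Kd : {fset Gamma} * R | Kd.1 != fset0 /\ 0 < Kd.2]
    (fun Kd => folner_sets Kd.1 Kd.2).

Lemma folner_setsS (K K' : {fset Gamma}) (d d' : R) :
  (K `<=` K')%fset -> d' <= d -> folner_sets K' d' `<=` folner_sets K d.
Proof.
move=> KK' dd' F [F0 hF]; split => //; apply: le_trans (le_trans hF _).
  by rewrite ler_wpM2r// lerB.
rewrite ler_nat fsubset_leq_card//; apply/fsubsetP => t.
rewrite !inE/= => /andP[-> /fsubsetP tF]; apply/fsubsetP => _ /imfsetP[k kK ->].
by apply: tF; apply/imfsetP; exists k => //; exact: (fsubsetP KK').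
Qed.

Global Instance folner_filter : Filter folner.
Proof.
apply: filter_from_filter.
  by exists ([fset 1%g]%fset, 1); split => //=; apply/fset0Pn; exists 1%g; rewrite inE.
move=> [K d] [K' d'] /= [/fset0Pn[k kK] d0] [_ d'0].
exists ((K `|` K')%fset, Num.min d d') => /=.
  by split; [apply/fset0Pn; exists k; rewrite inE kK|rewrite lt_min d0 d'0].
by move=> F hF; split; apply: folner_setsS hF;
  rewrite ?fsubsetUl ?fsubsetUr// ge_min lexx ?orbT.
Qed.

Lemma folner_proper : amenable -> ProperFilter folner.
Proof.
by move=> am; apply: filter_from_proper => -[K d] /= [K0 d0]; exact: am.
Qed.

Lemma cvg_folnerP (phi : {fset Gamma} -> R) (c : R) :
  phi @ folner --> c <->
  forall eps, 0 < eps -> exists (K : {fset Gamma}) (delta : R),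
    [/\ K != fset0, 0 < delta &
      forall F, folner_sets K delta F -> `|phi F - c| < eps].
Proof.
split=> [/cvgrPdist_lt cphi eps /cphi[[K d] /= [K0 d0] sub]|h].
  by exists K, d; split => // F /sub /=; rewrite distrC.
apply/cvgrPdist_lt => eps /h[K [d [K0 d0 sub]]].
by exists (K, d) => // F /sub /=; rewrite distrC.
Qed.

End Folner.

Arguments folner R Gamma : clear implicits.

Definition metrizable (R : realType) (T : topologicalType) : Prop :=
  exists d : T -> T -> R,
    [/\ forall x y, d x y = 0 <-> x = y,
        forall x y, d x y = d y x,
        forall x y z, d x z <= d x y + d y z &
        forall x, nbhs x = filter_from [set e : R | 0 < e]
                             (fun e => [set y | d x y < e])].

Record dynamical_system (R : realType) (Gamma : groupType)
    (T : topologicalType) (a : Gamma -> T -> T) : Prop := DynamicalSystem {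
  dyn_nonempty : [set: T] !=set0 ;
  dyn_compact : compact [set: T] ;
  dyn_metrizable : metrizable R T ;
  dyn_act1 : forall x, a 1%g x = x ;
  dyn_actM : forall s t x, a (s * t)%g x = a s (a t x) ;
  dyn_continuous : forall t, continuous (a t) }.

Definition factor_map (Gamma : groupType) (X Y : topologicalType)
    (aX : Gamma -> X -> X) (aY : Gamma -> Y -> Y) (pi : X -> Y) : Prop :=
  [/\ continuous pi, forall t x, pi (aX t x) = aY t (pi x) &
      forall y, exists x, pi x = y].

Definition G_extension (Gamma : groupType) (X Y G : topologicalType)
    (aX : Gamma -> X -> X) (aG : Gamma -> G -> G) (pi : X -> Y) : Prop :=
  exists r : X * G -> X,
    [/\ continuous r,
        forall x, pi @^-1` [set pi x] = [set r (x, g) | g in [set: G]],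
        forall x g g', r (x, g) = r (x, g') <-> g = g' &
        forall t x g, aX t (r (x, g)) = r (aX t x, aG t g)].

Definition is_max (A : set nat) (n : nat) : Prop :=
  A n /\ forall m, A m -> (m <= n)%N.
Definition is_min (A : set nat) (n : nat) : Prop :=
  A n /\ forall m, A m -> (n <= m)%N.

Section Covers.
Variable T : Type.
Implicit Types U V : set (set T).

Definition join U V : set (set T) := [set A `&` B | A in U & B in V].

Definition refines U V : Prop :=
  forall A, U A -> exists2 B, V B & A `<=` B.

(* The truncated predecessor is harmless: the maximum is at least 1 for
   a cover of a nonempty space. *)
Definition ord U : nat :=
  (xget 0%N
     (is_max (range (fun x : T => \sum_(A \in U) (x \in A : nat))))).-1.

(* U^F, the join over s in F of the covers s^-1 U *)
Definition cover_iter (Gamma : groupType) (a : Gamma -> T -> T) U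
    (F : {fset Gamma}) : set (set T) :=
  \big[join/[set [set: T]]]_(s <- F) [set a s^-1%g @` A | A in U].

Definition fibers (S : Type) (pi : T -> S) : set (set T) :=
  [set pi @^-1` [set y] | y in [set: S]].

End Covers.

Definition finite_open_cover (T : topologicalType) (U : set (set T)) : Prop :=
  [/\ finite_set U, forall A, U A -> open A &
      \bigcup_(A in U) A = [set: T]].

Section MeanDimension.
Variables (R : realType) (Gamma : groupType) (X : topologicalType).
Variable a : Gamma -> X -> X.

Definition relD (Y : Type) (pi : X -> Y) (U : set (set X)) : nat :=
  xget 0%N
    (is_min [set ord W | W in [set W | finite_open_cover W /\
                                  refines (join (fibers pi) W) U]]).

Definition rel_mdim (Y : Type) (pi : X -> Y) : \bar R :=
  ereal_sup
    [set (lim ((fun F : {fset Gamma} =>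
                  (relD pi (cover_iter a U F))%:R / #|` F|%:R : R)
                 @ folner R Gamma))%:E
    | U in [set U | finite_open_cover U]].

Definition mdim : \bar R := rel_mdim (fun _ : X => tt).

(* over a singleton the fibres impose no condition *)
Lemma refines_fibers_unit (W U : set (set X)) :
  refines (join (fibers (fun _ : X => tt)) W) U <-> refines W U.
Proof.
split=> h A.
  move=> WA; apply: h; exists [set: X]; first by exists tt => //; apply/seteqP.
  by exists A => //; rewrite setTI.
move=> [_ [y _ <-]] [B WB <-]; have [C UC BC] := h B WB.
by exists C => // x [_ /BC].
Qed.

End MeanDimension.

(* Main.v *)
Require Import Defs.
From mathcomp Require Import all_boot all_order all_algebra.
From mathcomp Require Import finmap.
From mathcomp Require Import all_classical all_reals all_analysis.
From mathcomp Require Import ring lra zify.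

(* The numbers D(U^F | Y) are subadditive in F and invariant under right
   translation of F, so D(U^F | Y) / |F| converges by the Ornstein-Weiss lemma;
   hence it suffices to compare D(U^F | Y) for X with D(V^F) for G, F by F.
   Such a comparison follows by pulling covers back along a continuous map.
   From X to G one uses g |-> x0 g for a fixed x0; by compactness V can be
   chosen on X such that, for every x, the trace of each member of V on xG
   lies in a single member of U. Only the fibre through t x0 matters for the
   translate by t, so the map need not be equivariant. From G to X one uses
   the map sending x to the g with tau(pi x) g = x, continuous by compactness,
   and a cover V of G whose members V satisfy xV inside a member of U for all x. *)

Import Order.TTheory GRing.Theory Num.Theory.
Import numFieldNormedType.Exports.
Local Open Scope classical_set_scope.
Local Open Scope ring_scope.

(** * Covers in compact spaces *)

(** Finite families of open members of [P], directed by inclusion, generate a filter; near each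
    point all large families cover, so near-covering compactness yields one family covering the
    whole space. *)
Lemma compact_finite_cover {T : topologicalType} (P : set (set T)) :
  compact [set: T] -> (forall x, exists2 A, P A & open_nbhs x A) ->
  exists2 U, finite_open_cover U & U `<=` P.
Proof.
move=> /compact_near_coveringP cT hP.
pose V (F : {fset set T}) := forall A, A \in F -> P A /\ open A.
have [N hN] : exists F : {fset set T}, V F /\ [set: T] `<=` \bigcup_(A in [set` F]) A.
  pose Fl := filter_from V (fun F => [set F' | [fset A in F]%fset `<=` F']%fset).
  have FlF : Filter Fl.
    apply: filter_from_filter; first by exists fset0.
    move=> i j Vi Vj; exists (i `|` j)%fset.
      by move=> A; rewrite inE => /orP[/Vi|/Vj].
    move=> F /fsubsetP hF; split; apply/fsubsetP => A; rewrite !inE => Ai;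
      by apply: hF; rewrite !inE Ai ?orbT.
  have := cT _ Fl (fun F x => exists2 A, A \in F & A x) FlF.
  case.
    move=> x _; have [A PA [oA Ax]] := hP x.
    exists (A, [set F : {fset set T} | A \in F]) => /=.
      split; first exact: open_nbhs_nbhs.
      exists [fset A]%fset; first by move=> B; rewrite inE => /eqP ->.
      by move=> F /fsubsetP /= -> //; rewrite !inE.
    by move=> [y F] /= [Ay AF]; exists A.
  move=> F VF hF; exists F; split => // x _.
  have [] := hF F _ x I; last by move=> A AF Ax; exists A.
  by apply/fsubsetP => A; rewrite !inE.
case: hN => VN cN; exists [set` N]; last by move=> A /VN[].
split; first exact: finite_fset.
  by move=> A /VN[].
by apply/seteqP.
Qed.

Lemma metrizable_hausdorff {R : realType} {T : topologicalType} :
  metrizable R T -> hausdorff_space T.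
Proof.
move=> [d [d0 dC dT nE]] x y xy; apply/d0/eqP; rewrite eq_le.
have dge0 u v : 0 <= d u v.
  have := dT u v u; rewrite (dC v u) (_ : d u u = 0); last exact/d0.
  by rewrite -mulr2n pmulrn_lge0.
rewrite dge0 andbT leNgt; apply/negP => dxy.
have [||z /= [xz yz]] := xy [set z | d x z < d x y / 2] [set z | d y z < d x y / 2].
- by rewrite nE; exists (d x y / 2) => //=; rewrite divr_gt0.
- by rewrite nE; exists (d x y / 2) => //=; rewrite divr_gt0.
have := le_lt_trans (dT x z y) (ltrD xz _).
by rewrite (dC z y) => /(_ _ yz); rewrite -splitr ltxx.
Qed.

(** The function is the distance to the complement of [U], or the constant [1] when that complement
    is empty. *)
Lemma metrizable_cozero {R : realType} {T : topologicalType} {U : set T} :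
  metrizable R T -> open U ->
  exists2 f : T -> R, continuous f & forall x, 0 < f x <-> U x.
Proof.
move=> [d [d0 dC dT nE]] oU.
have dge0 u v : 0 <= d u v.
  have := dT u v u; rewrite (dC v u) (_ : d u u = 0); last exact/d0.
  by rewrite -mulr2n pmulrn_lge0.
have [[z nUz]|UT] := pselect (exists z, ~ U z); last first.
  exists (fun=> 1); first exact: cst_continuous.
  by move=> x; split => // _; apply: contrapT => nUx; apply: UT; exists x.
pose E x := [set d x y | y in ~` U].
have lbE x : lbound (E x) 0 by move=> _ [y _ <-].
have infE x y : ~ U y -> inf (E x) <= d x y.
  by move=> nUy; apply: ge_inf; [exists 0|exists y].
have infL x y : inf (E x) <= d x y + inf (E y).
  rewrite -lerBlDl; apply: lb_le_inf; first by exists (d y z), z.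
  move=> _ [w nUw <-]; rewrite lerBlDl.
  exact: le_trans (infE _ _ nUw) (dT _ _ _).
exists (fun x => inf (E x)).
  move=> x; apply/cvgrPdist_lt => e e0; change (nbhs x [set y | `|inf (E x) - inf (E y)| < e]); rewrite nE; exists e => // y /= dxy.
  have := infL y x; have := infL x y; rewrite (dC y x) ltr_norml; lra.
move=> x; split => [fx|Ux].
  by apply: contrapT => /(infE x); rewrite (_ : d x x = 0) ?leNgt ?fx//; exact/d0.
have := open_nbhs_nbhs (conj oU Ux); rewrite nE => -[e /= e0 eU].
apply: lt_le_trans e0 _; apply: lb_le_inf; first by exists (d x z), z.
by move=> _ [y nUy <-]; rewrite leNgt; apply/negP => /eU.
Qed.

Section fibrewise_covers.
Context {X G Z : topologicalType} {r : X * G -> Z}.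
Hypothesis r_cont : continuous r.
Hypothesis compactX : compact [set: X].
Hypothesis compactG : compact [set: G].

(** A tube argument: for fixed [g], continuity gives near each [x] a neighbourhood of [g] that works
    for all nearby points, and compactness of [X] makes it independent of [x]. The member [B] may
    still vary with [x]. *)
Lemma cover_slices (U : set (set Z)) : finite_open_cover U ->
  exists2 V, finite_open_cover V &
    forall x A, V A -> exists2 B, U B & forall g, A g -> B (r (x, g)).
Proof.
move=> [_ oU cU].
pose P (A : set G) := forall x, exists2 B, U B & forall g, A g -> B (r (x, g)).
suff [V Vc VP] : exists2 V, finite_open_cover V & V `<=` P.
  by exists V => // x A /VP.
apply: compact_finite_cover => // g.
have : \forall N \near powerset_filter_from (nbhs g), [set: X] `<=`
    (fun x => exists2 B, U B & forall g, N g -> B (r (x, g))).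
  apply: ((compact_near_coveringP _).1 compactX _ (powerset_filter_from (nbhs g))
    (fun A x => exists2 B, U B & forall g, A g -> B (r (x, g)))).
  move=> x _; have [B UB Brx] : (\bigcup_(B in U) B) (r (x, g)) by rewrite cU.
  have [[C D] /= [Cx Dg] CD] := r_cont (x, g) B (open_nbhs_nbhs (conj (oU _ UB) Brx)).
  exists (C, [set A | A `<=` D]) => /=.
    by split => //; exact: small_set_sub.
  move=> [y A] /= [Cy AD]; exists B => // h Ah.
  by apply: (CD (y, h)); split => //=; exact: AD.
move=> /near_powerset_filter_fromP[|A].
  by move=> A B AB + x _ => /(_ x I)[C UC BC]; exists C => // h /AB /BC.
rewrite nbhsE => -[B [oB Bg] BA] hA; exists B; last by [].
by move=> x; have [C UC AC] := hA x I; exists C => // h /BA /AC.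
Qed.

(** For fixed [z] and [x], injectivity allows at most one solution of [r (x, g) = z], so a single
    member [B] contains it. On the compact complement of [B] the values [r (x, g)] are separated
    from [z], also for nearby [x]; compactness of [X] then gives one neighbourhood of [z] for all
    [x]. *)
Lemma cover_slices_preim (U : set (set G)) : hausdorff_space Z ->
  compact [set: Z] -> (forall x g g', r (x, g) = r (x, g') -> g = g') ->
  [set: G] !=set0 -> finite_open_cover U ->
  exists2 V, finite_open_cover V &
    forall x A, V A -> exists2 B, U B & forall g, A (r (x, g)) -> B g.
Proof.
move=> hZ compactZ r_inj [g0 _] [_ oU cU].
pose P (A : set Z) := forall x, exists2 B, U B & forall g, A (r (x, g)) -> B g.
suff [V Vc VP] : exists2 V, finite_open_cover V & V `<=` P.
  by exists V => // x A /VP.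
apply: compact_finite_cover => // z.
pose F := powerset_filter_from (nbhs z).
have : \forall N \near F, [set: X] `<=`
    (fun x => exists2 B, U B & forall g, N (r (x, g)) -> B g).
  apply: ((compact_near_coveringP _).1 compactX _ F
    (fun A x => exists2 B, U B & forall g, A (r (x, g)) -> B g)) => x _.
  have [B UB Bz] : exists2 B, U B & forall g, r (x, g) = z -> B g.
    have [[g gz]|nz] := pselect (exists g, r (x, g) = z).
      have [B UB Bg] : (\bigcup_(B in U) B) g by rewrite cU.
      by exists B => // h; rewrite -gz => /r_inj ->.
    (* If [z] is off the slice of [x], any member of [U] will do; [g0] supplies one. *)
    have [B UB _] : (\bigcup_(B in U) B) g0 by rewrite cU.
    by exists B => // g gz; case: nz; exists g.
  have cB : compact (~` B).
    by apply: (subclosed_compact _ compactG) => //; exact/open_closedC/oU.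
  have := (compact_near_coveringP _).1 cB _ (filter_prod (nbhs x) F)
    (fun xA g => ~ xA.2 (r (xA.1, g))) _.
  have hB g : ~ B g ->
      \forall g' \near g & xA \near filter_prod (nbhs x) F, ~ xA.2 (r (xA.1, g')).
    move=> nBg; have zr : r (x, g) != z by apply/eqP => /Bz.
    move: hZ; rewrite open_hausdorff => /(_ _ _ zr)[[C D] /= [rC zD] [oC oD CD]].
    have [[E1 E2] /= [E1x E2g] E12] :=
      r_cont (x, g) C (open_nbhs_nbhs (conj oC (set_mem rC))).
    exists (E2, [set xA | E1 xA.1 /\ xA.2 `<=` D]) => /=.
      split => //; exists (E1, [set A | A `<=` D]) => //=; split => //.
      by apply: small_set_sub; apply: open_nbhs_nbhs; split => //; exact: set_mem.
    move=> [g' [x' A]] /= [E2g' [E1x' AD]] /AD Dr.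
    have Cr := E12 (x', g') (conj E1x' E2g').
    by move/eqP/seteqP : CD => [/(_ _ (conj Cr Dr))].
  move=> /(_ _ hB) [[E1 E2] /= [E1x FE2] E12].
  exists (E1, E2) => // -[x' A] /= EA; exists B => // g Ag.
  by apply: contrapT => /(E12 (x', A) EA).
move=> /near_powerset_filter_fromP[|A].
  by move=> A B AB + x _ => /(_ x I)[C UC BC]; exists C => // h /AB /BC.
rewrite nbhsE => -[B [oB Bg] BA] hA; exists B; last by [].
by move=> x; have [C UC AC] := hA x I; exists C => // h /BA /AC.
Qed.

End fibrewise_covers.

(** Outside an open neighbourhood [B] of [g s] the equation fails at [s]. Since [Z] is Hausdorff
    this failure is an open condition, so by compactness of the complement of [B] it persists for
    [s'] near [s], and [g s'] stays in [B]. *)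
Lemma implicit_continuous {S G Z : topologicalType} {r : S * G -> Z}
    {f : S -> Z} {g : S -> G} :
  compact [set: G] -> hausdorff_space Z -> continuous r -> continuous f ->
  (forall s h, r (s, h) = f s <-> h = g s) -> continuous g.
Proof.
move=> compactG hZ r_cont f_cont rf s A; rewrite nbhsE => -[B [oB Bg] BA].
have cB : compact (~` B).
  by apply: (subclosed_compact _ compactG) => //; exact/open_closedC.
have hB h : ~ B h -> \forall h' \near h & s' \near s, r (s', h') <> f s'.
  move=> nBh; have zr : r (s, h) != f s by apply/eqP => /rf hg; apply: nBh; rewrite hg.
  move: hZ; rewrite open_hausdorff => /(_ _ _ zr)[[C D] /= [rC zD] [oC oD CD]].
  have [[E1 E2] /= [E1x E2g] E12] :=
    r_cont (s, h) C (open_nbhs_nbhs (conj oC (set_mem rC))).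
  exists (E2, E1 `&` (f @^-1` D)) => /=.
    split => //; apply: filterI => //; apply: f_cont.
    by apply: open_nbhs_nbhs; split => //; exact: set_mem.
  move=> [h' s'] /= [E2h [E1s Df]] eqf.
  have := E12 (s', h') (conj E1s E2h); rewrite /= eqf => Cr.
  by move/eqP/seteqP : CD => [/(_ _ (conj Cr Df))].
have : \forall s' \near s, ~` B `<=` (fun h => r (s', h) <> f s').
  exact: ((compact_near_coveringP _).1 cB _ (nbhs s)
    (fun s h => r (s, h) <> f s) _ hB).
apply: filterS => s' Es'; apply: BA; apply: contrapT => nB.
by apply: (Es' (g s') nB); apply/rf.
Qed.

(** * Subadditivity of the covering dimension *)

Lemma leq_card_imfset {T T' : choiceType} (f : T -> T') (A : {fset T}) :
  (#|` [fset f x | x in A]%fset| <= #|` A|)%N.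
Proof. exact: leq_imfset_card. Qed.

Definition multiplicity {T : Type} (W : {fset (set T)}) (x : T) : nat :=
  #|` [fset A in W | x \in A]%fset|.

(* W ranges over the families of "small" sets; in the application these are
   the sets whose traces on the fibres lie in members of the iterated cover. *)
Definition covdim_le {T : topologicalType} (C : set (set T)) (n : nat) : Prop :=
  exists W : {fset (set T)},
    [/\ forall A, A \in W -> open A /\ C A,
        forall x, exists2 A, A \in W & A x &
        forall x, (multiplicity W x <= n.+1)%N].

Lemma fsum_multiplicity {T : Type} (W : {fset (set T)}) (x : T) :
  (\sum_(A \in [set` W]) (x \in A : nat))%N = multiplicity W x.
Proof.
rewrite fsbig_finite /=; last exact: finite_fset.
rewrite set_fsetK /multiplicity.
transitivity (count (fun A : set T => x \in A) W).
  rewrite -sum1_count [RHS]big_mkcond /=.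
  by apply: eq_bigr => A _; case: (x \in A).
rewrite -size_filter; apply/perm_size/uniq_perm; rewrite ?filter_uniq ?fset_uniq//.
by move=> A; rewrite mem_filter !inE /= andbC.
Qed.

(** The maximum exists because multiplicities are bounded by the size of [W] and [T] is nonempty.
    The truncated predecessor does no harm: [m.-1 <= n] is equivalent to [m <= n.+1] also for
    [m = 0]. *)
Lemma ord_le {T : Type} (W : {fset (set T)}) (n : nat) : [set: T] !=set0 ->
  (ord [set` W] <= n)%N <-> forall x, (multiplicity W x <= n.+1)%N.
Proof.
move=> [x0 _]; rewrite /ord.
pose M := range (fun x : T => (\sum_(A \in [set` W]) (x \in A : nat))%N).
rewrite -/M.
have ME : M = range (multiplicity W).
  by rewrite /M; congr (image _ _); apply/funext => x; exact: fsum_multiplicity.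
have [m [[x _ xm] mM]] : exists m, is_max M m.
  have ubM m : `[< M m >] -> (m <= #|` W|)%N.
    move/asboolP; rewrite ME => -[x _ <-]; apply: fsubset_leq_card.
    by apply/fsubsetP => A; rewrite !inE /= => /andP[].
  have exM : exists m, `[< M m >].
    by exists (multiplicity W x0); apply/asboolP; rewrite ME; exists x0.
  have [m /asboolP Mm maxm] := ex_maxnP exM ubM.
  by exists m; split => // k /asboolP /maxm.
have -> : xget 0%N (is_max M) = m.
  apply: xget_unique; first by split => //; exists x.
  move=> k [Mk maxk]; apply/eqP; rewrite eqn_leq mM//= maxk//.
  by exists x.
have xm' : multiplicity W x = m by rewrite -xm fsum_multiplicity.
split=> [mn y|mn].
  apply: (@leq_trans m); last by case: (m) mn.
  by apply: mM; rewrite ME; exists y.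
by have := mn x; rewrite xm'; case: (m).
Qed.

(** Pulled-back sets through [x] come from members of [W] through [f x]; coinciding preimages only
    lower the count. *)
Lemma covdim_le_preimage {S T : topologicalType} (f : S -> T)
    (C : set (set S)) (D : set (set T)) (n : nat) :
  continuous f -> (forall A, D A -> C (f @^-1` A)) ->
  covdim_le D n -> covdim_le C n.
Proof.
move=> f_cont DC [W [oW cW mW]].
exists [fset f @^-1` A | A in W]%fset; split.
- move=> _ /imfsetP[A /= /oW[oA DA] ->]; split; last exact: DC.
  by apply: open_comp => // x _; exact: f_cont.
- move=> x; have [A AW Ax] := cW (f x); exists (f @^-1` A) => //.
  by apply/imfsetP; exists A.
- move=> x; apply: leq_trans (mW (f x)); rewrite /multiplicity.
  apply: leq_trans (leq_card_imfset (fun A => f @^-1` A)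
    [fset A in W | f x \in A]%fset).
  apply: fsubset_leq_card; apply/fsubsetP => B; rewrite !inE /=.
  move=> /andP[/imfsetP[A /= AW ->]] /set_mem /= Afx.
  by apply/imfsetP; exists A => //=; rewrite !inE AW; exact/mem_set.
Qed.

(** Pairwise intersections would only bound the multiplicity by [(n + 1)(m + 1)]. Instead, each
    member gets a function positive exactly on it, and the new sets record which functions dominate
    the others, like open stars of vertices in a barycentric subdivision. *)
Lemma covdim_leI {R : realType} {T : topologicalType} (C D : set (set T))
    (n m : nat) : metrizable R T ->
  (forall A B, A `<=` B -> C B -> C A) -> (forall A B, A `<=` B -> D B -> D A) ->
  covdim_le C n -> covdim_le D m -> covdim_le (C `&` D) (n + m).
Proof.
move=> mT hC hD [V [oV cV mV]] [W [oW cW mW]].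
have /choice[h hP] (A : set T) :
    exists f : T -> R, open A -> continuous f /\ forall x, 0 < f x <-> A x.
  have [oA|noA] := pselect (open A); last by exists (fun=> 0).
  by have [f] := metrizable_cozero mT oA; exists f.
have [N memN] : exists N : {fset set T + set T}, forall i,
    (i \in N) = match i with inl A => A \in V | inr A => A \in W end.
  exists ([fset inl A | A in V] `|` [fset inr A | A in W])%fset => -[A|A];
    rewrite !inE; apply/orP/idP.
  - by case=> /imfsetP[B  /= BV] // [->].
  - by move=> AV; left; apply/imfsetP; exists A.
  - by case=> /imfsetP[B  /= BW] // [->].
  - by move=> AW; right; apply/imfsetP; exists A.
pose un (i : set T + set T) := match i with inl A => A | inr A => A end.
pose H i := h (un i).
have NP i : i \in N -> continuous (H i) /\ forall x, 0 < H i x <-> un i x.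
  by rewrite memN; case: i => A AN; apply: hP; [have [] := oV _ AN|have [] := oW _ AN].
(* Upper level sets of a function on [N] form a chain, so the sets [L S] with
   [S] of a given cardinal are pairwise disjoint, and the cardinals of the
   relevant [S] range over [2 .. n + m + 2]. *)
pose L (S : {fset set T + set T}) : set T := [set x | forall i, i \in S ->
  0 < H i x /\ forall j, j \in N -> j \notin S -> H j x < H i x].
(* An index from each cover places [L S] inside a member of [V] and a member of [W], and forces [S]
   to have at least two elements. *)
pose good (S : {fset set T + set T}) :=
  [exists A : V, inl (val A) \in S] && [exists A : W, inr (val A) \in S].
have [I memI] : exists I : {fset {fset set T + set T}}, forall S,
    (S \in I) = (S `<=` N)%fset && good S.
  by exists [fset S in fpowerset N | good S]%fset => S; rewrite !inE /= fpowersetE.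
exists [fset L S | S in I]%fset; split.
- move=> _ /imfsetP[S /= + ->]; rewrite memI.
  move=> /and3P[SN /existsP[A AS] /existsP[B BS]]; split; last first.
    split.
      apply: hC (proj2 (oV _ (valP A))) => x /(_ _ AS)[+ _].
      by move=> /(NP _ (fsubsetP SN _ AS)).2.
    apply: hD (proj2 (oW _ (valP B))) => x /(_ _ BS)[+ _].
    by move=> /(NP _ (fsubsetP SN _ BS)).2.
  rewrite openE => x Lx.
  have op0 i : i \in S -> \forall y \near x, 0 < H i y.
    move=> iS; have [Hc _] := NP i (fsubsetP SN _ iS).
    exact: (cvgr_gt (H i x) (Hc x) 0 (proj1 (Lx i iS))).
  have opij i j : i \in S -> j \in N -> j \notin S -> \forall y \near x, H j y < H i y.
    move=> iS jN jS; have [Hi _] := NP i (fsubsetP SN _ iS).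
    have [Hj _] := NP j jN.
    have : 0 < H i x - H j x by rewrite subr_gt0; exact: (Lx i iS).2.
    move=> /(cvgr_gt (H i x - H j x) (cvgB (Hi x) (Hj x))).
    by apply: filterS => y /=; rewrite subr_gt0.
  apply: filterS (filter_bigI (D := S) (f := fun i => [set y | 0 < H i y /\
    forall j, j \in (N `\` S)%fset -> H j y < H i y]) _ _).
    move=> y /= Ly i iS; have [H0 Hij] := Ly i iS; split => // j jN jS.
    by apply: Hij; rewrite inE jS.
  move=> i iS; apply: filterI; first exact: op0.
  apply: filterS (filter_bigI (D := (N `\` S)%fset) (f := fun j => [set y | H j y < H i y]) _ _).
    by move=> y /= Ly j jN; exact: Ly.
  by move=> j; rewrite inE => /andP[jS jN]; exact: opij.
- move=> x; pose S := [fset i in N | 0 < H i x]%fset.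
  have inS i : i \in N -> un i x -> i \in S.
    by move=> iN ix; rewrite !inE iN /=; exact/(NP i iN).2.
  exists (L S).
    apply/imfsetP; exists S => //=; rewrite memI; apply/and3P; split.
    - by apply/fsubsetP => i; rewrite !inE => /andP[].
    - have [A AV Ax] := cV x; apply/existsP; exists [` AV]%fset; by apply: inS; rewrite ?memN.
    - have [A AV Ax] := cW x; apply/existsP; exists [` AV]%fset; by apply: inS; rewrite ?memN.
  move=> i; rewrite !inE => /andP[iN Hi]; split => // j jN.
  by rewrite !inE jN -leNgt => /le_lt_trans; apply.
- move=> x; rewrite /multiplicity.
  have chain S S' : S \in I -> S' \in I -> L S x -> L S' x ->
      #|` S| = #|` S'| -> S = S'.
    rewrite !memI => /andP[SN _] /andP[SN' _] LS LS' eqS.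
    suff : (S `<=` S')%fset || (S' `<=` S)%fset.
      case/orP => sub; apply/eqP; first by rewrite eqEfcard sub eqS leqnn.
      by rewrite eq_sym eqEfcard sub eqS leqnn.
    apply: contraT; rewrite negb_or => /andP[/fsubsetPn[i iS iS'] /fsubsetPn[j jS' jS]].
    have := lt_trans ((LS i iS).2 j (fsubsetP SN' _ jS') jS)
                     ((LS' j jS').2 i (fsubsetP SN _ iS) iS').
    by rewrite ltxx.
  set J := [fset A in _ | _]%fset.
  have [K memK] : exists K : {fset {fset set T + set T}}, forall S,
      (S \in K) = (S \in I) && (x \in L S).
    by exists [fset S in I | x \in L S]%fset => S; rewrite !inE.
  have -> : #|` J| = #|` [fset L S | S in K]%fset|.
    congr (#|` _|); apply/fsetP => A; rewrite !inE /=.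
    apply/andP/imfsetP => [[/imfsetP[S /= SI ->] xS]|[S /= + ->]].
      by exists S => //=; rewrite memK SI.
    by rewrite memK => /andP[SI xS]; split => //; apply/imfsetP; exists S.
  apply: leq_trans (leq_card_imfset _ _) _.
  have /card_in_imfsetP/eqP <- : {in K &, injective (fun S => #|` S|)}.
    move=> S S'; rewrite !memK => /andP[SI /set_mem LS] /andP[SI' /set_mem LS'].
    exact: chain.
  have szI : size (iota 2 (n + m).+1) = (n + m).+1 by rewrite size_iota.
  rewrite -[leqRHS]szI; apply: uniq_leq_size; first exact: fset_uniq.
  move=> k /imfsetP[S SK ->]; move: SK.
  rewrite [_ \in mem _]memK memI => /andP[/andP[SN]].
  move=> /andP[/existsP[A AS] /existsP[B BS]] /set_mem LS.
  rewrite mem_iota; apply/andP; split.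
    have /fsubset_leq_card : ([fset inl (val A); inr (val B)] `<=` S)%fset.
      by apply/fsubsetP => i; rewrite !inE => /orP[] /eqP ->.
    by rewrite cardfs2.
  pose Vx := [fset A in V | x \in A]%fset; pose Wx := [fset A in W | x \in A]%fset.
  have /fsubset_leq_card : (S `<=` [fset inl A | A in Vx] `|` [fset inr A | A in Wx])%fset.
    apply/fsubsetP => i iS; have iN := fsubsetP SN _ iS.
    have xi : un i x by apply/(NP i iN).2; exact: (LS i iS).1.
    move: iN xi {iS}; rewrite memN inE; case: i => A' AN xi; apply/orP; [left|right];
      by apply/imfsetP; exists A' => //=; rewrite !inE AN; exact: mem_set.
  move=> /leq_trans; apply.
  have := (leq_card_fsetU [fset inl A | A in Vx] [fset inr A | A in Wx])%fset.
  move=> [/leq_trans + _]; apply.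
  apply: leq_trans (leq_add (leq_card_imfset _ _) (leq_card_imfset _ _)) _.
  by apply: leq_trans (leq_add (mV x) (mW x)) _; rewrite addSn addnS.
Qed.

(** * The Ornstein-Weiss lemma *)

Section translates.
Context {Gamma : groupType}.
Implicit Types (K D E F : {fset Gamma}) (t c : Gamma).

Definition translate K t : {fset Gamma} := [fset (k * t)%g | k in K]%fset.

Definition boundary K D : {fset Gamma} :=
  [fset t in D | ~~ (translate K t `<=` D)%fset]%fset.

Lemma mem_translate K t x : (x \in translate K t) = ((x * t^-1)%g \in K).
Proof.
apply/imfsetP/idP => [[k /= kK ->]|xK]; first by rewrite mulgK.
by exists (x * t^-1)%g => //=; rewrite mulgVK.
Qed.

Lemma card_translate K t : #|` translate K t| = #|` K|.
Proof.
apply/eqP/card_in_imfsetP => x y _ _ /(congr1 (fun z => (z * t^-1)%g)).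
by rewrite !mulgK.
Qed.

Lemma mem_boundary K D t :
  (t \in boundary K D) = (t \in D) && ~~ (translate K t `<=` D)%fset.
Proof. by rewrite !inE. Qed.

Lemma boundaryP {K D t} : t \in D ->
  reflect (exists2 k, k \in K & (k * t)%g \notin D) (t \in boundary K D).
Proof.
move=> tD; rewrite mem_boundary tD; apply: (iffP (fsubsetPn _ _)).
  by move=> [_ /imfsetP[k /= kK ->] ktD]; exists k.
by move=> [k kK ktD]; exists (k * t)%g => //; apply/imfsetP; exists k.
Qed.

Lemma boundaryS K K' D : (K `<=` K')%fset -> (boundary K D `<=` boundary K' D)%fset.
Proof.
move=> /fsubsetP KK'; apply/fsubsetP => t tb.
have tD : t \in D by move: tb; rewrite mem_boundary => /andP[].
by have /(boundaryP tD)[k /KK' kK ktD] := tb; apply/boundaryP => //; exists k.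
Qed.

Lemma boundary_sub K D : (boundary K D `<=` D)%fset.
Proof. by apply/fsubsetP => t; rewrite mem_boundary => /andP[]. Qed.

Lemma folner_setsE {R : realType} K (delta : R) F :
  folner_sets K delta F <->
  F != fset0 /\ #|` boundary K F|%:R <= delta * #|` F|%:R.
Proof.
rewrite /folner_sets /=; set I := [fset t in F | _]%fset.
have -> : I = (F `\` boundary K F)%fset.
  apply/fsetP => t; rewrite in_fsetD mem_boundary !inE /=.
  by case: (t \in F); rewrite ?andbF ?andbT ?negbK.
rewrite cardfsDS ?boundary_sub// natrB ?fsubset_leq_card ?boundary_sub//.
by split=> -[F0 h]; split => //; lra.
Qed.

(* K'^-1 K \ K *)
Definition collar K' K : {fset Gamma} :=
  [fset x in [seq (k'^-1 * k)%g | k' <- K', k <- K] | x \notin K]%fset.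

Lemma mem_collar {K' K x k'} :
  k' \in K' -> (k' * x)%g \in K -> x \notin K -> x \in collar K' K.
Proof.
move=> k'K kK xK; rewrite !inE xK andbT; apply/allpairsP.
by exists (k', (k' * x)%g); rewrite /= mulKg.
Qed.

(** If [k'^-1 * k] leaves [K], then [k] is a boundary point of [K] for the inverses of [K']. Hence
    the collar is small once [K] is almost invariant under these inverses. *)
Lemma card_collar K' K :
  (#|` collar K' K| <= #|` K'| * #|` boundary [fset k^-1%g | k in K']%fset K|)%N.
Proof.
rewrite -(size_allpairs (fun k' k => k'^-1 * k)%g).
apply: uniq_leq_size; first exact: fset_uniq.
move=> x; rewrite !inE /= => /andP[/allpairsP[[k' k] /= [k'K kK ->]] nK].
apply/allpairsP; exists (k', k) => /=; split => //.
by apply/boundaryP => //; exists k'^-1%g => //; apply/imfsetP; exists k'.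
Qed.

(** A new boundary point [t] lies outside [translate K c] but some [k * t] lies inside, so [t] is in
    the collar translated by [c]. *)
Lemma boundary_setD {K' K D E c} : (translate K c `<=` D)%fset ->
  (#|` boundary K' (D `\` (E `|` translate K c))%fset| <=
   #|` boundary K' (D `\` E)%fset| + #|` collar K' K|)%N.
Proof.
move=> KcD; rewrite -(card_translate (collar K' K) c).
apply: leq_trans (leq_card_fsetU _ _).1.
apply/fsubset_leq_card/fsubsetP => t tb.
have : t \in (D `\` (E `|` translate K c))%fset := fsubsetP (boundary_sub _ _) _ tb.
have := tb => /boundaryP tbP tDE; have [k kK] := tbP tDE.
move: tDE; rewrite !in_fsetD !in_fsetU !negb_or => /andP[/andP[tE tK] tD].
rewrite !negb_and !negbK => /orP[/orP[ktE|ktK]|ktD].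
- by apply/orP; left; apply/boundaryP; rewrite ?in_fsetD ?tE//; exists k; rewrite ?in_fsetD ?ktE.
- apply/orP; right; rewrite mem_translate; apply: (mem_collar kK).
    by rewrite mulgA -mem_translate.
  by rewrite -mem_translate.
- apply/orP; left; apply/boundaryP; rewrite ?in_fsetD ?tE//; exists k => //.
  by rewrite in_fsetD (negbTE ktD) andbF.
Qed.

(** Double counting: a point [e] lies in [translate K c] for at most [|K|] elements [c], those of
    the form [k^-1 * e]. *)
Lemma sum_card_translate K E (C : {fset Gamma}) :
  (\sum_(c <- C) #|` (translate K c `&` E)%fset| <= #|` E| * #|` K|)%N.
Proof.
have cardE (A : {fset Gamma}) (p : pred Gamma) : #|` [fset x in A | p x]%fset| =
    (\sum_(x <- A) p x)%N.
  transitivity (count p A).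
    rewrite -size_filter; apply/perm_size/uniq_perm; rewrite ?filter_uniq ?fset_uniq//.
    by move=> x; rewrite mem_filter !inE /= andbC.
  by rewrite -sum1_count big_mkcond /=; apply: eq_bigr => x _; case: (p x).
rewrite (eq_bigr (fun c => \sum_(e <- E) (e \in translate K c : nat))%N); last first.
  move=> c _; rewrite -cardE; congr (#|` _|); apply/fsetP => x.
  by rewrite !inE /= andbC.
rewrite exchange_big /= [leqRHS]mulnC -[#|` E|]sum1_size big_distrr /=.
apply: leq_sum => e _; rewrite muln1 -cardE.
apply: leq_trans (leq_card_imfset (fun k => k^-1 * e)%g K).
apply: fsubset_leq_card; apply/fsubsetP => c; rewrite !inE /= mem_translate.
move=> /andP[_ eK]; apply/imfsetP; exists (e * c^-1)%g => //=.
by rewrite invgM invgK mulgVK.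
Qed.

End translates.

Section ornstein_weiss.
Context {R : realType} {Gamma : groupType} {phi : {fset Gamma} -> R}.
Hypothesis phi_ge0 : forall A, 0 <= phi A.
Hypothesis phi0 : phi fset0 = 0.
Hypothesis phiU : forall A B, phi (A `|` B)%fset <= phi A + phi B.
Hypothesis phi_translate : forall A t, phi (translate A t) = phi A.
Implicit Types (K D E F : {fset Gamma}) (q c : R).

Lemma phi_le_card F : phi F <= phi [fset 1%g]%fset * #|` F|%:R.
Proof.
elim/fset1U_rect: F => [|x F xF IH]; first by rewrite phi0 cardfs0 mulr0.
apply: le_trans (phiU _ _) _; rewrite cardfsU1 xF natrD mulrDr mulr1 lerD//.
have -> : [fset x]%fset = translate [fset 1%g]%fset x.
  by apply/fsetP => y; rewrite mem_translate !inE divg_eq1.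
by rewrite phi_translate.
Qed.

(* Add translates of K inside D one at a time, as long as a fraction at least q
   of the new translate is new. When this stops, every translate of K inside D
   has a fraction at least 1 - q in E, and double counting bounds |E| below. *)
Lemma greedy_packing q K D : 0 < q -> K != fset0 ->
  exists E m, [/\ (E `<=` D)%fset, phi E <= m%:R * phi K,
    m%:R * q * #|` K|%:R <= #|` E|%:R,
    (1 - q) * (#|` D|%:R - #|` boundary K D|%:R) <= #|` E|%:R &
    forall K', (#|` boundary K' (D `\` E)%fset| <=
                #|` boundary K' D| + m * #|` collar K' K|)%N].
Proof.
move=> q0 K0; have K0' : 0 < #|` K|%:R :> R by rewrite ltr0n cardfs_gt0.
pose good E m := [/\ (E `<=` D)%fset, phi E <= m%:R * phi K,
    m%:R * q * #|` K|%:R <= #|` E|%:R &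
    forall K', (#|` boundary K' (D `\` E)%fset| <=
                #|` boundary K' D| + m * #|` collar K' K|)%N].
(* A [good] set of maximal size stands in for the end of the greedy process: a translate with too
   small an overlap could still be added. *)
pose P s := `[< exists E m, good E m /\ #|` E| = s >].
have exP : exists s, P s.
  exists 0%N; apply/asboolP; exists fset0, 0%N; rewrite cardfs0; split => //; split.
  - exact: fsub0set.
  - by rewrite phi0 mul0r.
  - by rewrite !mul0r.
  - by move=> K'; rewrite fsetD0 mul0n addn0.
have ubP s : P s -> (s <= #|` D|)%N.
  by move/asboolP => [E [m [[ED _ _ _] <-]]]; exact: fsubset_leq_card.
have [_ /asboolP[E [m [[ED phiE mE bE] <-]]] maxE] := ex_maxnP exP ubP.
exists E, m; split => //.
have EK t : t \in (D `\` boundary K D)%fset ->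
    (1 - q) * #|` K|%:R <= #|` (translate K t `&` E)%fset|%:R :> R.
  rewrite in_fsetD mem_boundary negb_and negbK => /andP[/orP[/negP//|KtD] tD].
  rewrite leNgt; apply/negP => small.
  have cardEK : #|` (E `|` translate K t)%fset|%:R =
      #|` E|%:R + #|` K|%:R - #|` (translate K t `&` E)%fset|%:R :> R.
    by rewrite -(card_translate K t) -natrD -cardfsUI natrD fsetIC addrK.
  have : P #|` (E `|` translate K t)%fset|.
    apply/asboolP; exists (E `|` translate K t)%fset, m.+1; split => //; split.
    - by rewrite fsubUset ED.
    - apply: le_trans (phiU _ _) _; rewrite phi_translate -addn1 natrD.
      by rewrite mulrDl mul1r lerD2r.
    - rewrite cardEK -addn1 natrD; lra.
    - move=> K'; apply: leq_trans (boundary_setD KtD) _.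
      by have := bE K'; rewrite mulSn; lia.
  move=> /maxE; rewrite -(ler_nat R) cardEK.
  by have := mulr_gt0 q0 K0'; lra.
rewrite -(ler_pM2r K0').
have := sum_card_translate K E (D `\` boundary K D)%fset.
rewrite -(ler_nat R) natrM; apply: le_trans.
rewrite -natrB ?fsubset_leq_card ?boundary_sub// -cardfsDS ?boundary_sub//.
rewrite natr_sum [leRHS]big_seq mulrAC mulr_natr.
apply: le_trans (_ : \sum_(t <- (D `\` boundary K D)%fset) (1 - q) * #|` K|%:R <= _).
  by rewrite big_const_seq count_predT iter_addr_0.
by rewrite big_seq; apply: ler_sum => t /EK.
Qed.

(* Quasi-tiling: F is covered by translates of tiles with phi <= c |tile|, up to
   a remainder D. Each induction step packs one more tile into the remainder and
   multiplies its size by q, up to eta; D has to stay almost invariant under the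
   next (smaller) tile, which is why K' is arbitrary. *)
Lemma tower q c (M : nat) K' (eta : R) : 0 < q -> q < 1 -> 0 <= c ->
  (forall K (d : R), K != fset0 -> 0 < d ->
     exists2 F, folner_sets K d F & phi F <= c * #|` F|%:R) ->
  0 < eta ->
  exists K (d : R), [/\ K != fset0, 0 < d & forall F, folner_sets K d F ->
    exists D, [/\ (D `<=` F)%fset, q * phi (F `\` D)%fset <= c * #|` (F `\` D)%fset|%:R,
      #|` D|%:R <= (q ^+ M + eta) * #|` F|%:R &
      #|` boundary K' D|%:R <= eta * #|` F|%:R]].
Proof.
move=> q0 q1 c0 freq; elim: M => [|M IH] in K' eta * => eta0.
  exists (1%g |` K')%fset, eta; split => //.
    by apply/fset0Pn; exists 1%g; rewrite !inE eqxx.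
  move=> F /folner_setsE[F0 bF]; exists F; rewrite fsetDv phi0 cardfs0 !mulr0.
  split => //.
    by rewrite expr0 mulrDl mul1r lerDl mulr_ge0// ltW.
  apply: le_trans bF; rewrite ler_nat fsubset_leq_card// boundaryS//.
  exact: fsubsetUr.
pose Ki := [fset k^-1%g | k in K']%fset.
(* Makes the bound of [card_collar] at most [eta / 2 * q * |K1|], where [q] is later absorbed by
   [m * q * |K1| <= |E|]; the [+ 1] covers an empty [K']. *)
pose d1 := (eta / 2) * q / (#|` K'|%:R + 1).
have d1_gt0 : 0 < d1 by rewrite divr_gt0 ?mulr_gt0 ?divr_gt0// addr_gt0 ?ltr01// ltr_wpDl.
have [|K1 /folner_setsE[K10 bK1] phiK1] := freq (1%g |` Ki)%fset d1 _ d1_gt0.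
  by apply/fset0Pn; exists 1%g; rewrite !inE eqxx.
have collarK1 : #|` collar K' K1|%:R <= (eta / 2) * q * #|` K1|%:R :> R.
  apply: (@le_trans _ _ (#|` K'|%:R * (d1 * #|` K1|%:R))).
    apply: le_trans (_ : (#|` K'| * #|` boundary Ki K1|)%:R <= _).
      by rewrite ler_nat card_collar.
    rewrite natrM ler_wpM2l//; apply: le_trans bK1.
    by rewrite ler_nat fsubset_leq_card// boundaryS// fsubsetUr.
  rewrite mulrA ler_wpM2r// /d1 mulrCA ger_pMr ?mulr_gt0 ?divr_gt0//.
  by rewrite ler_pdivrMr ?ltr_wpDl// mul1r lerDl.
have eta20 : 0 < eta / 2 by rewrite divr_gt0.
(* Invariance under [K1] lets the packing fill [D], invariance under [K'] is passed on; half of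
   [eta] is kept for the collars. *)
have [K [d [K0 d0 hK]]] := IH (K1 `|` K')%fset (eta / 2) eta20.
exists K, d; split => // F /hK[D [DF phiD cardD bD]].
have [E [m [ED phiE mE cardE bE]]] := greedy_packing q K1 D q0 K10.
exists (D `\` E)%fset.
have bK1D : #|` boundary K1 D|%:R <= eta / 2 * #|` F|%:R :> R.
  by apply: le_trans bD; rewrite ler_nat fsubset_leq_card// boundaryS// fsubsetUl.
have bK'D : #|` boundary K' D|%:R <= eta / 2 * #|` F|%:R :> R.
  by apply: le_trans bD; rewrite ler_nat fsubset_leq_card// boundaryS// fsubsetUr.
have EF : #|` E|%:R <= #|` F|%:R :> R.
  by rewrite ler_nat fsubset_leq_card// (fsubset_trans ED).
have FDE : (F `\` (D `\` E) = (F `\` D) `|` E)%fset.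
  by rewrite fsetDDr; congr (_ `|` _)%fset; apply/fsetIidPr/(fsubset_trans ED).
have cFDE : #|` (F `\` D `|` E)%fset|%:R = #|` (F `\` D)%fset|%:R + #|` E|%:R :> R.
  rewrite cardfsU (_ : _ `&` _ = fset0)%fset ?cardfs0 ?subn0 ?natrD//.
  apply/fsetP => x; rewrite !inE; apply/negP => /andP[/andP[xD _] /(fsubsetP ED)].
  by rewrite (negbTE xD).
split.
- by rewrite (fsubset_trans _ DF)// fsubsetDl.
- rewrite FDE cFDE; apply: le_trans (ler_wpM2l (ltW q0) (phiU _ _)) _.
  rewrite !mulrDr lerD//.
  apply: le_trans _ (ler_wpM2l c0 mE); rewrite [leRHS](_ : _ = q * (m%:R * (c * #|` K1|%:R))).
    by rewrite ler_wpM2l ?(ltW q0)//; apply: le_trans phiE _; rewrite ler_wpM2l.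
  by ring.
(* The packing leaves at most [q * |D| + (1 - q) * |boundary K1 D|] points. *)
- rewrite cardfsDS// natrB ?fsubset_leq_card// exprS.
  have qD := ler_wpM2l (ltW q0) cardD.
  have q1' : 0 <= 1 - q by rewrite subr_ge0 ltW.
  have bq := ler_wpM2l q1' bK1D.
  have eF : 0 <= eta / 2 * #|` F|%:R by rewrite mulr_ge0// ltW.
  lra.
- apply: le_trans (_ : (#|` boundary K' D| + m * #|` collar K' K1|)%:R <= _).
    by rewrite ler_nat.
  rewrite natrD natrM.
  have mcollar := ler_wpM2l (ler0n R m) collarK1.
  have eE := ler_wpM2l (ltW eta20) (le_trans mE EF).
  lra.
Qed.

(** A quasi-tiling by tiles of ratio at most [c] controls [phi] on [F] up to a small remainder,
    where [phi_le_card] applies. This passes from arbitrarily invariant sets to all sufficiently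
    invariant ones. *)
Lemma frequently_eventually c (e : R) :
  (forall K (d : R), K != fset0 -> 0 < d ->
     exists2 F, folner_sets K d F & phi F <= c * #|` F|%:R) ->
  0 < e ->
  exists K (d : R), [/\ K != fset0, 0 < d & forall F, folner_sets K d F ->
    phi F <= (c + e) * #|` F|%:R].
Proof.
move=> freq e0.
have c0 : 0 <= c.
  have [||F /folner_setsE[F0 _] phiF] := freq [fset 1%g]%fset 1.
  - by apply/fset0Pn; exists 1%g; rewrite !inE.
  - by [].
  - have := le_trans (phi_ge0 F) phiF.
    by rewrite pmulr_lge0// ltr0n cardfs_gt0.
pose M := phi [fset 1%g]%fset.
have M0 : 0 <= M := phi_ge0 _.
(* Chosen so that [c / q <= c + e / 3]; adding [1] keeps [q] positive for [c = 0]. *)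
pose q := (c + 1) / (c + 1 + e / 3).
have den0 : 0 < c + 1 + e / 3 by lra.
have q0 : 0 < q by rewrite divr_gt0//; lra.
have q1 : q < 1 by rewrite ltr_pdivrMr// mul1r; lra.
have cq : c <= q * (c + e / 3).
  rewrite /q mulrAC ler_pdivlMr//; nra.
(* The remainder will have density at most [q ^+ N + eta <= 2 * eta], which costs at most
   [2 * e / 3]. *)
pose eta := e / (3 * (M + 1)).
have eta0 : 0 < eta by rewrite divr_gt0// mulr_gt0// ltr_wpDl.
have Meta : M * eta <= e / 3.
  rewrite /eta mulrA ler_pdivrMr ?mulr_gt0// ?ltr_wpDl//; lra.
have [N Nq] : exists N, q ^+ N <= eta.
  have := @cvg_expr R q; rewrite ger0_norm ?(ltW q0)// => /(_ q1).
  move=> /cvgrPdist_lt/(_ eta eta0)[N _ /(_ N (leqnn N))] /=.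
  by rewrite sub0r normrN ger0_norm ?exprn_ge0 ?(ltW q0)// => /ltW; exists N.
have [K [d [K0 d0 hK]]] := tower q c N fset0 eta q0 q1 c0 freq eta0.
exists K, d; split => // F /hK[D [DF phiFD cardD _]].
have FD0 : 0 <= #|` F|%:R :> R by [].
have FE : (F `\` D `|` D)%fset = F.
  apply/fsetP => x; rewrite in_fsetU in_fsetD; case xD : (x \in D) => /=.
    by rewrite (fsubsetP DF).
  by rewrite orbF.
have := phiU (F `\` D)%fset D; rewrite FE => phiF.
have phiD : phi D <= M * ((q ^+ N + eta) * #|` F|%:R).
  by apply: le_trans (phi_le_card D) _; rewrite ler_wpM2l.
have phiFD' : phi (F `\` D)%fset <= (c + e / 3) * #|` F|%:R.
  rewrite -(ler_pM2l q0); apply: le_trans phiFD _; rewrite mulrA.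
  by rewrite ler_pM// ler_nat fsubset_leq_card// fsubsetDl.
apply: le_trans phiF _.
have : M * ((q ^+ N + eta) * #|` F|%:R) <= (e / 3 + e / 3) * #|` F|%:R.
  rewrite mulrA ler_wpM2r// mulrDr lerD//.
  by apply: le_trans Meta; rewrite ler_wpM2l.
nra.
Qed.

(** The ratios lie in a segment, so they have a cluster point [c], approached on arbitrarily
    invariant sets. [frequently_eventually] turns this into an eventual upper bound; if the lower
    bound failed, the same lemma would keep the ratios eventually away from [c]. *)
Lemma ornstein_weiss : amenable R Gamma ->
  cvg ((fun F => phi F / #|` F|%:R) @ folner R Gamma).
Proof.
move=> am; have PF := folner_proper am.
pose M := phi [fset 1%g]%fset; pose u F := phi F / #|` F|%:R.
have cardF K (d : R) F : folner_sets K d F -> 0 < #|` F|%:R :> R.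
  by move=> [F0 _]; rewrite ltr0n cardfs_gt0.
have K1 : [fset 1%g]%fset != fset0 :> {fset Gamma}.
  by apply/fset0Pn; exists 1%g; rewrite !inE.
have uM : (u @ folner R Gamma) `[0, M]%classic.
  exists ([fset 1%g]%fset, 1) => //= F /cardF F0.
  rewrite /= in_itv /= divr_ge0//= ler_pdivrMr//.
  exact: phi_le_card.
have [c [_ clc]] := segment_compact _ uM.
have meet K (d : R) (B : set R) : K != fset0 -> 0 < d -> nbhs c B ->
    exists2 F, folner_sets K d F & B (u F).
  move=> K0 d0 Bc.
  have [|_ [[F KF <-] BuF]] := clc [set u F | F in folner_sets K d] B _ Bc.
    by exists (K, d) => //= F KF; exists F.
  by exists F.
apply/cvg_ex; exists c; apply/cvgrPdist_lt => e e0.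
have e2 : 0 < e / 2 by lra.
have e3 : 0 < e / 3 by lra.
have [K [d [K0 d0 upper]]] : exists K (d : R), [/\ K != fset0, 0 < d &
    forall F, folner_sets K d F -> u F < c + e].
  have [|K [d [K0 d0 hK]]] := frequently_eventually (c + e / 3) (e / 3) _ e3.
  - move=> K d K0 d0.
    have [|F KF uF] := meet K d [set x | x < c + e / 3] K0 d0.
      by apply: lt_nbhsl; lra.
    by exists F => //; rewrite -ler_pdivrMr ?(cardF _ _ _ KF)// ltW.
  - exists K, d; split => // F KF; have F0 := cardF _ _ _ KF.
    by apply: le_lt_trans (_ : c + e / 3 + e / 3 < _); [rewrite ler_pdivrMr// hK|lra].
have [K' [d' [K'0 d'0 lower]]] : exists K (d : R), [/\ K != fset0, 0 < d &
    forall F, folner_sets K d F -> c - e < u F].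
  apply: contrapT => nlower.
  have [|K' [d' [K'0 d'0 hK]]] := frequently_eventually (c - e) (e / 2) _ e2.
    move=> K' d' K'0 d'0; apply: contrapT => nF; apply: nlower.
    exists K', d'; split => // F KF; rewrite ltNge; apply/negP => uF; apply: nF.
    by exists F => //; rewrite -ler_pdivrMr ?(cardF _ _ _ KF).
  have [|F KF uF] := meet K' d' [set x | c - e / 2 < x] K'0 d'0.
    by apply: lt_nbhsr; lra.
  have := hK F KF; rewrite -ler_pdivrMr ?(cardF _ _ _ KF)// -/(u F).
  by move: uF => /=; lra.
have : (folner R Gamma) (folner_sets K d `&` folner_sets K' d').
  by apply: filterI; [exists (K, d)|exists (K', d')].
apply: filterS => F /= [/upper + /lower]; rewrite ltr_norml -/(u F); lra.
Qed.

End ornstein_weiss.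

(** * Relative mean dimension *)

Section iterated_covers.
Context {Gamma : groupType} {X : topologicalType} {Y : Type}.
Context {a : Gamma -> X -> X} { pi : X -> Y}.
Hypothesis a1 : forall x, a 1%g x = x.
Hypothesis aM : forall s t x, a (s * t)%g x = a s (a t x).

(** Choosing a member of [U] separately for each [s] and each fibre avoids the iterated join, and
    makes unions of [F] correspond to intersections of these families. *)
Definition fibrewise_small (U : set (set X)) (F : {fset Gamma}) : set (set X) :=
  [set A | forall s, s \in F -> forall y, exists2 B, U B &
    forall x, A x -> pi x = y -> B (a s x)].

Lemma sub_cover_iter (U : set (set X)) (F : {fset Gamma}) (A : set X) :
  (exists2 B, cover_iter a U F B & A `<=` B) <->
  forall s, s \in F -> exists2 B, U B & forall x, A x -> B (a s x).
Proof.
rewrite /cover_iter -/(enum_fset F).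
have -> : (forall s, s \in F -> exists2 B, U B & forall x, A x -> B (a s x)) <->
    (forall s, s \in enum_fset F -> exists2 B, U B & forall x, A x -> B (a s x)) by [].
elim: (enum_fset F) => [|t l IH].
  by rewrite big_nil; split=> // _; exists [set: X].
rewrite big_cons; split.
  move=> [_ [_ [B UB <-] [C lC <-]] ABC] s; rewrite inE => /orP[/eqP ->|sl].
    exists B => // x /ABC[[y By <-] _].
    by rewrite -aM mulgV a1.
  by apply: IH.1 sl; exists C => // x /ABC[].
move=> h; have [B UB AB] := h t (mem_head _ _).
have [C lC AC] : exists2 C, (\big[@join X/[set [set: X]]]_(s <- l)
    [set a s^-1%g @` A | A in U]) C & A `<=` C.
  by apply: IH.2 => s sl; apply: h; rewrite inE sl orbT.
exists ((a t^-1%g @` B) `&` C).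
  by exists (a t^-1%g @` B); [exists B|exists C].
move=> x Ax; split; last exact: AC.
by exists (a t x); [exact: AB|rewrite -aM mulVg a1].
Qed.

Lemma refines_cover_iter (W U : set (set X)) (F : {fset Gamma}) :
  refines (join (fibers pi) W) (cover_iter a U F) <-> W `<=` fibrewise_small U F.
Proof.
split=> [h A WA s sF y|h _ [_ [y _ <-] [A WA <-]]].
  have [|B iB AB] := h (pi @^-1` [set y] `&` A).
    by exists (pi @^-1` [set y]); [exists y|exists A].
  have [|C UC AC] := (sub_cover_iter U F (pi @^-1` [set y] `&` A)).1 _ s sF.
    by exists B.
  by exists C => // x Ax xy; apply: AC.
apply/sub_cover_iter => s sF; have [B UB AB] := h A WA s sF y.
by exists B => // x [xy Ax]; exact: AB.
Qed.

Lemma fibrewise_smallS (U : set (set X)) (F : {fset Gamma}) (A B : set X) :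
  A `<=` B -> fibrewise_small U F B -> fibrewise_small U F A.
Proof.
by move=> AB hB s sF y; have [C UC BC] := hB s sF y; exists C => // x /AB /BC.
Qed.

Hypothesis X0 : [set: X] !=set0.
Hypothesis compactX : compact [set: X].
Hypothesis a_cont : forall t, continuous (a t).

(** Compactness provides a finite open cover by fibrewise small sets, so the minimum in [relD]
    exists and the default value of [xget] is not reached. *)
Lemma relD_le (U : set (set X)) (F : {fset Gamma}) (n : nat) :
  finite_open_cover U ->
  (relD pi (cover_iter a U F) <= n)%N <-> covdim_le (fibrewise_small U F) n.
Proof.
move=> [_ oU cU]; rewrite /relD; set S := [set ord W | W in _].
have SP k : (exists2 m, S m & (m <= k)%N) <-> covdim_le (fibrewise_small U F) k.
  split=> [[_ [W [[fW oW cW] /refines_cover_iter sW] <-] ordW]|].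
    have [V WV] := finite_fsetP.1 fW; subst W.
    exists V; split; last exact/ord_le.
      by move=> A AV; split; [exact: oW|exact: sW].
    move=> x; have [A VA Ax] : (\bigcup_(A in [set` V]) A) x by rewrite cW.
    by exists A.
  move=> [V [oV cV mV]]; exists (ord [set` V]); last exact/ord_le.
  exists [set` V] => //; split; last first.
    by apply/refines_cover_iter => A /oV[].
  split; first exact: finite_fset.
    by move=> A /oV[].
  by apply/seteqP; split => // x _; have [A AV Ax] := cV x; exists A.
have exS : exists m, `[< S m >].
  have [W [fW oW cW] sW] : exists2 W, finite_open_cover W & W `<=` fibrewise_small U F.
    apply: compact_finite_cover => // x.
    have /choice[B hB] (s : Gamma) : exists B, U B /\ B (a s x).
      by have [B UB Bx] : (\bigcup_(B in U) B) (a s x) by [rewrite cU]; exists B.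
    have : nbhs x (\bigcap_(s in [set` F]) (a s @^-1` B s)).
      apply: filter_bigI => s _; apply: a_cont; apply: open_nbhs_nbhs.
      by have [/oU] := hB s.
    rewrite nbhsE => -[A xA AB]; exists A => // s sF y.
    by exists (B s); [have [] := hB s|move=> z /AB /(_ s sF)].
  by exists (ord W); apply/asboolP; exists W => //; split => //; exact/refines_cover_iter.
have [m /asboolP Sm minm] := ex_minnP exS.
have -> : xget 0%N (is_min S) = m.
  apply: xget_unique; first by split => // k Sk; apply: minm; exact/asboolP.
  move=> k [Sk mink]; apply/eqP; rewrite eqn_leq mink//= minm//; exact/asboolP.
rewrite -SP; split=> [mn|[k Sk kn]]; first by exists m.
by apply: leq_trans kn; apply: minm; exact/asboolP.
Qed.

End iterated_covers.

(** Subadditivity comes from [covdim_leI]; translating [F] by [t] is a pullback along [a t], which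
    by equivariance carries fibres into fibres. *)
Lemma relD_cvg {R : realType} {Gamma : groupType} {X : topologicalType} {Y : Type}
    {a : Gamma -> X -> X} {b : Gamma -> Y -> Y} { pi : X -> Y} {U : set (set X)} :
  amenable R Gamma -> dynamical_system R a ->
  (forall t x, pi (a t x) = b t (pi x)) -> finite_open_cover U ->
  cvg ((fun F : {fset Gamma} =>
    (relD pi (cover_iter a U F))%:R / #|` F|%:R : R) @ folner R Gamma).
Proof.
move=> am [X0 cX mX a1 aM ac] pib Uc.
have DP F n := @relD_le _ _ _ _ pi a1 aM X0 cX ac U F n Uc.
have D_translate F t :
    (relD pi (cover_iter a U (translate F t)) <= relD pi (cover_iter a U F))%N.
  apply/DP; apply: (covdim_le_preimage (a t) _
    (fibrewise_small (a := a) (pi := pi) U F) _ (ac t)); last exact/DP.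
  move=> A sA s; rewrite mem_translate => sF y.
  have [B UB AB] := sA _ sF (b t y); exists B => // x Ax xy.
  by have := AB (a t x) Ax; rewrite pib xy -aM mulgVK; apply.
apply: ornstein_weiss => //.
- apply/eqP; rewrite pnatr_eq0 -leqn0; apply/DP.
  exists [fset ([set: X] : set X)]%fset; split.
  + by move=> A; rewrite inE => /eqP ->; split; [exact: openT|move=> s; rewrite inE].
  + by move=> x; exists [set: X]; rewrite ?inE.
  + move=> x; rewrite -(cardfs1 [set: X]); apply/fsubset_leq_card.
    exact: fset_sub.
- move=> F E; rewrite -natrD ler_nat; apply/DP.
  pose C := fibrewise_small (a := a) (pi := pi) U.
  rewrite -/C (_ : C (F `|` E)%fset = C F `&` C E); last first.
    apply/seteqP; split=> [A h|A [hF hE] s].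
      by split=> s sF; apply: h; rewrite inE sF ?orbT.
    by rewrite inE => /orP[/hF|/hE].
  apply: (covdim_leI _ _ _ _ mX); [exact: fibrewise_smallS|exact: fibrewise_smallS|..];
    exact/DP.
- move=> F t; apply/eqP; rewrite eqr_nat eqn_leq D_translate/=.
  have {1}-> : F = translate (translate F t) t^-1%g; last exact: D_translate.
  by apply/fsetP => x; rewrite !mem_translate invgK mulgK.
Qed.

(** The pullback along [p] gives the inequality at each [F]; it passes to the limits, which exist on
    both sides, and then to the suprema. *)
Lemma rel_mdim_le {R : realType} {Gamma : groupType} {X Z : topologicalType}
    {Y T : Type} {a : Gamma -> X -> X} {b : Gamma -> Y -> Y} { pi : X -> Y}
    {c : Gamma -> Z -> Z} {d : Gamma -> T -> T} {rho : Z -> T} {p : X -> Z} :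
  amenable R Gamma -> dynamical_system R a -> dynamical_system R c ->
  (forall t x, pi (a t x) = b t (pi x)) ->
  (forall t z, rho (c t z) = d t (rho z)) ->
  continuous p ->
  (forall U, finite_open_cover U -> exists2 V, finite_open_cover V & forall F A,
    fibrewise_small (a := c) (pi := rho) V F A ->
    fibrewise_small (a := a) (pi := pi) U F (p @^-1` A)) ->
  (rel_mdim R a pi <= rel_mdim R c rho)%E.
Proof.
move=> am ha hc pib rhod p_cont UV; have PF := folner_proper am.
apply: ge_ereal_sup => _ [U Uc <-]; have [V Vc VU] := UV U Uc.
apply: le_ereal_sup_tmp; eexists; first by exists V.
rewrite lee_fin; have cU := relD_cvg am ha pib Uc; have cV := relD_cvg am hc rhod Vc.
rewrite -subr_ge0 -limB//; apply: limr_ge; first exact: is_cvgB.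
apply: nearW => F /=; rewrite subr_ge0 ler_wpM2r ?invr_ge0// ler_nat.
case: ha hc => X0 cX _ a1 aM ac [Z0 cZ _ c1 cM cc].
apply/(relD_le a1 aM X0 cX ac _ _ _ Uc).
apply: (covdim_le_preimage p _ _ _ p_cont (VU F)).
exact/(relD_le c1 cM Z0 cZ cc _ _ _ Vc).
Qed.

(** * Comparison of a [G]-extension with the system on [G] *)

Theorem proposition2p8 (R : realType) (Gamma : groupType)
    (X Y G : topologicalType)
    (aX : Gamma -> X -> X) (aY : Gamma -> Y -> Y) (aG : Gamma -> G -> G)
    (pi : X -> Y) :
  countable [set: Gamma] -> amenable R Gamma ->
  dynamical_system R aX -> dynamical_system R aY -> dynamical_system R aG ->
  factor_map aX aY pi -> G_extension aX aG pi ->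
  (mdim R aG <= rel_mdim R aX pi)%E /\
  ((exists2 tau : Y -> X, continuous tau & cancel tau pi) ->
   rel_mdim R aX pi = mdim R aG).
Proof.
move=> _ am hX _ hG [pi_cont pi_eq _] [r [r_cont r_fib r_inj r_eq]].
have [[x0 _] cX mX _ _ _] := hX; have [G0 cG mG _ _ _] := hG.
have hausX := metrizable_hausdorff mX.
have pi_r x g : pi (r (x, g)) = pi x.
  by have : (pi @^-1` [set pi x]) (r (x, g)) by rewrite r_fib; exists g.
have lower : (mdim R aG <= rel_mdim R aX pi)%E.
  have p_cont : continuous (r \o (fun g : G => (x0, g))).
    move=> g; apply: continuous_comp; last exact: r_cont.
    by apply: cvg_pair => //; exact: cvg_cst.
  apply: (rel_mdim_le (b := fun=> id) (pi := fun=> tt)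
    am hG hX (fun _ _ => erefl) pi_eq p_cont) => U Uc.
  have [|V Vc VU] := cover_slices_preim r_cont cX cG U hausX cX _ G0 Uc.
    by move=> x g g' /r_inj.
  exists V => // F A sA s sF [].
  (* By equivariance [s] moves the slice through [x0] to the one through [aX s x0], where [VU]
     applies. *)
  have [B VB AB] := sA s sF (pi x0); have [C UC BC] := VU (aX s x0) B VB.
  by exists C => // g Ag _; apply: BC; rewrite -r_eq; exact: AB.
split => // -[tau tau_cont tauK]; apply/eqP; rewrite eq_le lower andbT.
have /choice[gam gamP] x : exists g, r (tau (pi x), g) = x.
  have : (pi @^-1` [set pi (tau (pi x))]) x by rewrite /= tauK.
  by rewrite r_fib => -[g _ gx]; exists g.
have gam_cont : continuous gam.
  (* [gam x] is the unique solution [g] of [r (tau (pi x), g) = x]. *)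
  apply: (implicit_continuous (r := fun xg => r (tau (pi xg.1), xg.2)) (f := id) cG hausX).
  - have tau_pi_cont : continuous (tau \o pi).
      by move=> x; apply: continuous_comp; [exact: pi_cont|exact: tau_cont].
    have rt_cont : continuous (r \o (fun xg : X * G => ((tau \o pi) xg.1, xg.2))).
      move=> xg; apply: continuous_comp; last exact: r_cont.
      apply: cvg_pair => /=; last exact: cvg_snd.
      have : continuous ((tau \o pi) \o (fst : X * G -> X)).
        by move=> yg; apply: continuous_comp; [exact: cvg_fst|exact: tau_pi_cont].
      exact.
    exact: rt_cont.
  - by move=> x; exact: cvg_id.
  - move=> x g /=; split=> [rx|->]; last exact: gamP.
    by apply/(r_inj (tau (pi x))); rewrite rx gamP.
apply: (rel_mdim_le (d := fun=> id) (rho := fun=> tt)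
  am hX hG pi_eq (fun _ _ => erefl) gam_cont) => U Uc.
have [V Vc VU] := cover_slices r_cont cX cG U Uc.
exists V => // F A sA s sF y.
have [B VB AB] := sA s sF tt; have [C UC BC] := VU (aX s (tau y)) B VB.
(* A point [x] over [y] equals [r (tau y, gam x)], so [s] sends it into the slice through
   [aX s (tau y)]. *)
exists C => // x Ax xy; rewrite -(gamP x) xy r_eq.
by apply: BC; exact: AB.
Qed.
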